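(* There exists a finite partial monitoring game (finite $k$ and finite $\mathcal Z$) such that, in the Rustichini setting, $$\limsup_{n\to\infty}\frac{\log(\mathfrak R_n^\star)}{\log(n)}=\frac47.$$
   Context: A $k$-action partial monitoring game: set $\mathcal Z$, loss $\mathcal L:[k]\times\mathcal Z\to[0,1]$ (in the paper's example losses may take values up to $2$, which is immaterial after rescaling), signal $\mathcal S:[k]\times\mathcal Z\to\Sigma$. $\mathcal K$ = probability simplex on finite $\mathcal Z$; $\Delta_k$ = probability simplex on $[k]$; $\mathcal L(\pi,x)=\sum_{a,z}\pi(a)x(z)\mathcal L(a,z)$; $\mathcal S(a,x)$ = law of $\mathcal S(a,z)$, $z\sim x$. Rustichini setting: $x\,\mathrm R\,y$ iff $\mathcal S(a,x)=\mathcal S(a,y)$ for all $a$; $\mathcal V(\pi,x)=\sup_{y\,\mathrm R\,x}\mathcal L(\pi,y)$; $\mathcal V_\star(x)=\min_{\pi\in\Delta_k}\mathcal V(\pi,x)$. Interaction: adversary fixes $x_1,\dots,x_n\in\mathcal K$, $z_t\sim x_t$ independent and unobserved; learner chooses $\pi_t$ from past actions/signals, samples $a_t\sim\pi_t$, observes $\sigma_t=\mathcal S(a_t,z_t)$. Regret $\mathbb E[\sum_t\mathcal V(\pi_t,x_t)]-n\mathcal V_\star(\frac1n\sum_tx_t)$; $\mathfrak R_n^\star$ = infimum over learners of the supremum over adversary sequences of the regret. *)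

(* Defs.v *)
From HB Require Import structures.
From mathcomp Require Import all_boot all_order all_algebra.
From mathcomp Require Import all_classical all_reals all_analysis.
Set Implicit Arguments. Unset Strict Implicit. Unset Printing Implicit Defensive.
Import Order.TTheory GRing.Theory Num.Theory.
Local Open Scope ring_scope.
Local Open Scope classical_set_scope.

Section PM.
Variables (R : realType) (k : nat) (Z Sigma : finType).
Variables (L : 'I_k -> Z -> R) (S : 'I_k -> Z -> Sigma).

Definition simplex (T : finType) (p : {ffun T -> R}) : Prop :=
  (forall t, 0 <= p t) /\ \sum_(t : T) p t = 1.

Definition lossPM (pi : {ffun 'I_k -> R}) (x : {ffun Z -> R}) : R :=
  \sum_(a : 'I_k) \sum_(z : Z) pi a * x z * L a z.

Definition sigLaw (a : 'I_k) (x : {ffun Z -> R}) (s : Sigma) : R :=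
  \sum_(z : Z | S a z == s) x z.

Definition sigEquiv (x y : {ffun Z -> R}) : Prop :=
  forall a s, sigLaw a x s = sigLaw a y s.

Definition Vpm (pi : {ffun 'I_k -> R}) (x : {ffun Z -> R}) : R :=
  sup [set lossPM pi y | y in [set y | simplex y /\ sigEquiv y x]].

Definition Vstar (x : {ffun Z -> R}) : R :=
  inf [set Vpm pi x | pi in [set pi | simplex pi]].

Definition history := seq ('I_k * Sigma).
Definition learner := history -> {ffun 'I_k -> R}.
Definition valid_learner (lr : learner) : Prop := forall h, simplex (lr h).

Definition valid_adversary (n : nat) (xs : nat -> {ffun Z -> R}) : Prop :=
  forall t, (t < n)%N -> simplex (xs t).

(* expected value of sum_{t0 <= t < t0 + m} V(pi_t, x_t) given history h at time t0:
   a_t ~ pi_t = lr h, z_t ~ x_t independent, sigma_t = S(a_t, z_t) *)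
Fixpoint expV (lr : learner) (xs : nat -> {ffun Z -> R}) (m t : nat) (h : history) : R :=
  match m with
  | 0 => 0
  | m'.+1 => Vpm (lr h) (xs t) +
      \sum_(a : 'I_k) \sum_(z : Z)
         lr h a * xs t z * expV lr xs m' t.+1 (rcons h (a, S a z))
  end.

Definition avgx (n : nat) (xs : nat -> {ffun Z -> R}) : {ffun Z -> R} :=
  [ffun z => n%:R^-1 * \sum_(t < n) xs t z].

Definition regret (n : nat) (lr : learner) (xs : nat -> {ffun Z -> R}) : R :=
  expV lr xs n 0 [::] - n%:R * Vstar (avgx n xs).

Definition minimax_regret (n : nat) : R :=
  inf [set sup [set regret n lr xs | xs in [set xs | valid_adversary n xs]]
      | lr in [set lr | valid_learner lr]].

End PM.

Definition loss_in_01 (R : realType) (k : nat) (Z : finType) (L : 'I_k -> Z -> R) : Prop :=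
  forall a z, 0 <= L a z <= 1.

(* Main.v *)
Require Import Defs.
From HB Require Import structures.
From mathcomp Require Import all_boot all_order all_algebra.
From mathcomp Require Import all_classical all_reals all_analysis.
From mathcomp Require Import ring lra.
Set Implicit Arguments. Unset Strict Implicit. Unset Printing Implicit Defensive.
Import Order.TTheory GRing.Theory Num.Theory numFieldNormedType.Exports.
Local Open Scope ring_scope.

(** The outcome is a pair of bits; let [v] and [w] be the marginal probabilities
    that they are true.  An action combines one of three modes with a guess
    about the first bit; a seventh action (loss 1) reveals the second bit.
    The guess costs [v / 2] or [(1 - v) / 2].  The modes have worst-case loss
    [min v w / 2] (reveals nothing: the [min] is the best coupling of two
    marginals that are never observed together), [v / 2] and [w / 2] (both
    reveal the first bit).  So the guess has to be learned through the
    revealing modes; these cost [(v - w)^+ / 2] and [(w - v)^+ / 2], hence the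
    cheap one is known only to a learner who has paid for the seventh action.

    With [r = n^(-1/7)], the learner uses the revealing modes with probability
    [r], the seventh action with probability [r^3], and runs projected gradient
    descent on the guess and on the choice of the revealing mode.  The guess
    costs [sqrt (n / r)], the choice of mode [r * sqrt (n / r^3)], the seventh
    action [n * r^3]: all equal to [r^-4 = n^(4/7)].

    For the lower bound the adversary is stationary with [v = 1/2 +- r^3/8] and
    [w = 1/2 +- r^2], uniform signs.  If [alpha], [beta] are the posterior means
    of the signs, then
    [(r^3 / 32) * (remaining rounds) * max 0 (1 - alpha^2 - 2 * beta^2)]
    bounds the remaining Bayesian regret from below. *)

(** * Sums over outcomes and averages against distributions *)

Lemma sum_bool_pair (V : nmodType) (F : bool * bool -> V) :
  \sum_(z : bool * bool) F z =
  F (true, true) + F (true, false) + (F (false, true) + F (false, false)).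
Proof.
rewrite (eq_bigr (fun p => F (p.1, p.2))); last by case.
by rewrite -(pair_bigA _ (fun i j => F (i, j))) /= !big_bool.
Qed.

Lemma simplex_sum_le (R : realType) (T : finType) (p : {ffun T -> R})
  (F : T -> R) (c : R) : simplex p -> (forall t, F t <= c) ->
  \sum_t p t * F t <= c.
Proof.
case=> p0 p1 Fc; have -> : c = \sum_t p t * c by rewrite -big_distrl /= p1 mul1r.
by apply: ler_sum => t _; rewrite ler_wpM2l.
Qed.

Lemma simplex_sum_ge (R : realType) (T : finType) (p : {ffun T -> R})
  (F : T -> R) (c : R) : simplex p -> (forall t, c <= F t) ->
  c <= \sum_t p t * F t.
Proof.
case=> p0 p1 Fc; have -> : c = \sum_t p t * c by rewrite -big_distrl /= p1 mul1r.
by apply: ler_sum => t _; rewrite ler_wpM2l.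
Qed.

(** * The game *)

Section Game.
Variable R : realType.
Implicit Types (pi : {ffun 'I_7 -> R}) (x y : {ffun bool * bool -> R}).

(* Actions [0, 1] hide, [2, 3] and [4, 5] reveal the first bit, [6] reveals the
   second bit; the parity is the guess. *)
Definition game_loss (a : 'I_7) (z : bool * bool) : R :=
  match nat_of_ord a with
  | 0 => ((z.1 && z.2)%:R + z.1%:R) / 2
  | 1 => ((z.1 && z.2)%:R + (~~ z.1)%:R) / 2
  | 2 => (z.1%:R + z.1%:R) / 2
  | 3 => (z.1%:R + (~~ z.1)%:R) / 2
  | 4 => (z.2%:R + z.1%:R) / 2
  | 5 => (z.2%:R + (~~ z.1)%:R) / 2
  | _ => 1
  end.

Definition game_signal (a : 'I_7) (z : bool * bool) : bool :=
  match nat_of_ord a with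
  | 0 | 1 => true
  | 2 | 3 | 4 | 5 => z.1
  | _ => z.2
  end.

Definition prob1 x : R := x (true, true) + x (true, false).
Definition prob2 x : R := x (true, true) + x (false, true).

(** The value of a pure action as a function of the two marginals; only the hiding actions depend on
    how the bits are coupled. *)
Definition worst_loss (a : 'I_7) (v w : R) : R :=
  match nat_of_ord a with
  | 0 => (Num.min v w + v) / 2
  | 1 => (Num.min v w + (1 - v)) / 2
  | 2 => (v + v) / 2
  | 3 => (v + (1 - v)) / 2
  | 4 => (w + v) / 2
  | 5 => (w + (1 - v)) / 2
  | _ => 1
  end.

Definition signal_prob (a : 'I_7) (v w : R) : R :=
  match nat_of_ord a with
  | 0 | 1 => 1
  | 2 | 3 | 4 | 5 => v
  | _ => w
  end.

Lemma ord7_ind (P : 'I_7 -> Prop) :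
  P (inord 0) -> P (inord 1) -> P (inord 2) -> P (inord 3) -> P (inord 4) ->
  P (inord 5) -> P (inord 6) -> forall a, P a.
Proof.
move=> P0 P1 P2 P3 P4 P5 P6 a; rewrite -(inord_val a).
by case: a => [[|[|[|[|[|[|[|a]]]]]]] lta].
Qed.

Lemma game_loss01 : loss_in_01 game_loss.
Proof.
by elim/ord7_ind => -[[] []]; rewrite /game_loss inordK //=; lra.
Qed.

Lemma simplex_sum4 x : simplex x ->
  x (true, true) + x (true, false) + (x (false, true) + x (false, false)) = 1.
Proof. by case=> _ <-; rewrite sum_bool_pair. Qed.

Lemma prob1_bounds x : simplex x -> 0 <= prob1 x <= 1.
Proof.
move=> sx; have := simplex_sum4 sx; case: sx => x0 _; rewrite /prob1.
move: (x0 (true, true)) (x0 (true, false)) (x0 (false, true)) (x0 (false, false)).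
lra.
Qed.

Lemma prob2_bounds x : simplex x -> 0 <= prob2 x <= 1.
Proof.
move=> sx; have := simplex_sum4 sx; case: sx => x0 _; rewrite /prob2.
move: (x0 (true, true)) (x0 (true, false)) (x0 (false, true)) (x0 (false, false)).
lra.
Qed.

Lemma sigLaw_sum4 a x s : let F z := if game_signal a z == s then x z else 0 in
  sigLaw game_signal a x s =
  F (true, true) + F (true, false) + (F (false, true) + F (false, false)).
Proof. by rewrite /= /sigLaw big_mkcond sum_bool_pair. Qed.

Lemma sigEquiv_probs x y : sigEquiv game_signal x y ->
  prob1 x = prob1 y /\ prob2 x = prob2 y.
Proof.
move=> exy; move: (exy (inord 2) true) (exy (inord 6) true).
by rewrite !sigLaw_sum4 /game_signal !inordK //= !addr0 ?add0r.
Qed.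

Lemma probs_sigEquiv x y : simplex x -> simplex y ->
  prob1 x = prob1 y -> prob2 x = prob2 y -> sigEquiv game_signal x y.
Proof.
move=> /simplex_sum4 sx /simplex_sum4 sy; rewrite /prob1 /prob2 => e1 e2.
by elim/ord7_ind => s; rewrite !sigLaw_sum4 /game_signal !inordK //=; case: s => /=; lra.
Qed.

Lemma mean_loss_le x a : simplex x ->
  \sum_z x z * game_loss a z <= worst_loss a (prob1 x) (prob2 x).
Proof.
move=> sx; have := simplex_sum4 sx; case: sx => x0 _.
move: (x0 (true, true)) (x0 (true, false)) (x0 (false, true)) (x0 (false, false)).
rewrite sum_bool_pair; elim/ord7_ind: a;
  rewrite /game_loss /worst_loss /prob1 /prob2 inordK //=; try lra.
all: rewrite minEle; case: ifP; lra.
Qed.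

(* Puts as much mass as possible on both bits being true, which is the worst
   case for every action simultaneously. *)
Definition coupling (v w : R) : {ffun bool * bool -> R} :=
  [ffun z => match z with
    | (true, true) => Num.min v w
    | (true, false) => v - Num.min v w
    | (false, true) => w - Num.min v w
    | (false, false) => 1 - v - w + Num.min v w
    end].

Lemma coupling_prob1 v w : prob1 (coupling v w) = v.
Proof. by rewrite /prob1 !ffunE; lra. Qed.

Lemma coupling_prob2 v w : prob2 (coupling v w) = w.
Proof. by rewrite /prob2 !ffunE; lra. Qed.

Lemma simplex_coupling v w : 0 <= v <= 1 -> 0 <= w <= 1 ->
  simplex (coupling v w).
Proof.
move=> v01 w01; split; last by rewrite sum_bool_pair !ffunE; lra.
by case=> [[] []]; rewrite ffunE minEle; case: ifP; lra.
Qed.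

Lemma mean_loss_coupling v w a :
  \sum_z coupling v w z * game_loss a z = worst_loss a v w.
Proof.
rewrite sum_bool_pair !ffunE; elim/ord7_ind: a;
  rewrite /game_loss /worst_loss inordK //=; lra.
Qed.

Lemma lossPM_mean pi x :
  lossPM game_loss pi x = \sum_a pi a * \sum_z x z * game_loss a z.
Proof.
apply: eq_bigr => a _; rewrite big_distrr /=.
by apply: eq_bigr => z _; rewrite mulrA.
Qed.

(** A single coupling maximizes the loss of all actions at once, so the supremum commutes with the
    average over [pi]. *)
Lemma Vpm_game pi x : simplex pi -> simplex x ->
  Vpm game_loss game_signal pi x =
  \sum_a pi a * worst_loss a (prob1 x) (prob2 x).
Proof.
move=> [pi0 _] sx; set s := \sum_a _.
rewrite /Vpm; set E := (X in sup X).
have ubE : ubound E s.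
  move=> _ [y [sy /sigEquiv_probs [e1 e2]] <-].
  rewrite lossPM_mean /s -e1 -e2; apply: ler_sum => a _.
  by rewrite ler_wpM2l // mean_loss_le.
have Es : E s.
  exists (coupling (prob1 x) (prob2 x)).
    have sc := simplex_coupling (prob1_bounds sx) (prob2_bounds sx).
    by split => //; apply: probs_sigEquiv => //;
      rewrite (coupling_prob1, coupling_prob2).
  by rewrite lossPM_mean; apply: eq_bigr => a _; rewrite mean_loss_coupling.
apply/eqP; rewrite eq_le; apply/andP; split.
  by apply: ge_sup => //; exists s.
by apply: ub_le_sup => //; exists s.
Qed.

Lemma sum_signal x a (G : bool -> R) : simplex x ->
  \sum_z x z * G (game_signal a z) =
  signal_prob a (prob1 x) (prob2 x) * G true +
  (1 - signal_prob a (prob1 x) (prob2 x)) * G false.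
Proof.
move=> /simplex_sum4 sx; rewrite sum_bool_pair.
have {sx}-> : x (false, false) = 1 - x (true, true) - x (true, false) - x (false, true).
  by rewrite -sx; ring.
elim/ord7_ind: a; rewrite /game_signal /signal_prob /prob1 /prob2 inordK //=; ring.
Qed.

Lemma expV_succ lr xs m t h : simplex (lr h) -> simplex (xs t) ->
  let v := prob1 (xs t) in let w := prob2 (xs t) in
  expV game_loss game_signal lr xs m.+1 t h =
  \sum_a lr h a * (worst_loss a v w +
    (signal_prob a v w *
       expV game_loss game_signal lr xs m t.+1 (rcons h (a, true)) +
     (1 - signal_prob a v w) *
       expV game_loss game_signal lr xs m t.+1 (rcons h (a, false)))).
Proof.
move=> slr sx v w /=; rewrite Vpm_game // -big_split /=.
apply: eq_bigr => a _; rewrite mulrDr; congr (_ + _).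
rewrite -(sum_signal a
  (fun s => expV game_loss game_signal lr xs m t.+1 (rcons h (a, s)))) //.
by rewrite big_distrr; apply: eq_bigr => z _; rewrite /= mulrA.
Qed.

Lemma simplex_dirac (T : finType) (a : T) : simplex [ffun b => (b == a)%:R : R].
Proof.
split=> [t|]; first by rewrite ffunE ler0n.
rewrite (bigD1 a) //= ffunE eqxx big1 ?addr0 // => b /negPf ba.
by rewrite ffunE ba.
Qed.

(** The loss of the hiding mode with the better guess; [Vstar] at any law with these marginals. *)
Definition star (v w : R) : R := (Num.min v w + Num.min v (1 - v)) / 2.

Lemma star_le_worst a v w : 0 <= v <= 1 -> 0 <= w <= 1 ->
  star v w <= worst_loss a v w.
Proof.
move=> v01 w01; rewrite /star minEle [Num.min v (1 - v)]minEle.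
elim/ord7_ind: a; rewrite /worst_loss inordK //= ?minEle;
  case: ifP => ?; case: ifP => ?; lra.
Qed.

Lemma star_le_Vpm pi x : simplex pi -> simplex x ->
  star (prob1 x) (prob2 x) <= Vpm game_loss game_signal pi x.
Proof.
move=> spi sx; rewrite Vpm_game //; apply: simplex_sum_ge => // a.
by rewrite star_le_worst // (prob1_bounds, prob2_bounds).
Qed.

Lemma Vstar_game x : simplex x ->
  Vstar game_loss game_signal x = star (prob1 x) (prob2 x).
Proof.
move=> sx; apply/eqP; rewrite eq_le; apply/andP; split; last first.
  apply: lb_le_inf.
    eexists; exists [ffun b => (b == ord0)%:R]; last by [].
    exact: simplex_dirac.
  by move=> _ [pi spi <-]; apply: star_le_Vpm.
pose a : 'I_7 := if prob1 x <= 1 - prob1 x then inord 0 else inord 1.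
have -> : star (prob1 x) (prob2 x) =
    Vpm game_loss game_signal [ffun b => (b == a)%:R] x.
  rewrite Vpm_game //; last exact: simplex_dirac.
  rewrite (bigD1 a) //= big1 => [|b /negPf ba]; last by rewrite ffunE ba mul0r.
  rewrite ffunE eqxx mul1r addr0 /star /a [Num.min _ (1 - _)]minEle.
  by case: ifP; rewrite /worst_loss inordK.
apply: ge_inf; last by eexists; first exact: simplex_dirac.
by exists (star (prob1 x) (prob2 x)) => _ [pi spi <-]; apply: star_le_Vpm.
Qed.

(** * Crude bounds on the regret *)

Lemma simplex_avgx n (xs : nat -> {ffun bool * bool -> R}) : (0 < n)%N ->
  valid_adversary n xs -> simplex (avgx n xs).
Proof.
move=> n0 vx; split=> [z|].
  rewrite ffunE mulr_ge0 // ?invr_ge0 // sumr_ge0 // => t _.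
  by case: (vx t (ltn_ord t)).
under eq_bigr do rewrite ffunE.
rewrite -big_distrr exchange_big /=.
under eq_bigr => t _ do rewrite (proj2 (vx t (ltn_ord t))).
by rewrite sumr_const card_ord mulVf // pnatr_eq0 -lt0n.
Qed.

Lemma expV_le lr xs m t h : valid_learner lr ->
  (forall i, (t <= i < t + m)%N -> simplex (xs i)) ->
  expV game_loss game_signal lr xs m t h <= m%:R.
Proof.
move=> vl; elim: m t h => [|m IH] t h vx; first by [].
have sx : simplex (xs t) by apply: vx; rewrite leqnn addnS ltnS leq_addr.
rewrite expV_succ //.
have IHm s : expV game_loss game_signal lr xs m t.+1 s <= m%:R.
  apply: IH => i /andP[ti im]; apply: vx.
  by rewrite (ltnW ti) addnS -addSn.
apply: simplex_sum_le => // a; rewrite -natr1 addrC; apply: lerD.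
  have := IHm (rcons h (a, true)); have := IHm (rcons h (a, false)).
  have : 0 <= signal_prob a (prob1 (xs t)) (prob2 (xs t)) <= 1.
    move: (prob1_bounds sx) (prob2_bounds sx).
    by elim/ord7_ind: a; rewrite /signal_prob inordK //=; lra.
  nra.
move: (prob1_bounds sx) (prob2_bounds sx).
by elim/ord7_ind: a; rewrite /worst_loss inordK //= ?minEle; try case: ifP; lra.
Qed.

(** Bounds the set of regrets from above, so that the [sup] over adversaries is a genuine supremum
    for every learner. *)
Lemma regret_le n lr xs : (0 < n)%N -> valid_learner lr ->
  valid_adversary n xs -> regret game_loss game_signal n lr xs <= n%:R.
Proof.
move=> n0 vl vx; have sa := simplex_avgx n0 vx.
rewrite /regret lerBlDr (le_trans (expV_le _ vl _)) //.
rewrite lerDl mulr_ge0 // Vstar_game // /star.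
move: (prob1_bounds sa) (prob2_bounds sa).
by rewrite minEle [Num.min _ (1 - _)]minEle; case: ifP; case: ifP; lra.
Qed.

End Game.

Lemma sum_ord7 (V : nmodType) (F : 'I_7 -> V) :
  \sum_a F a = F (inord 0) + (F (inord 1) + (F (inord 2) + (F (inord 3) +
    (F (inord 4) + (F (inord 5) + F (inord 6)))))).
Proof.
rewrite !big_ord_recl big_ord0 addr0.
by do ?congr (_ + _); congr F; apply: val_inj; rewrite /= inordK.
Qed.

(** * Upper bound *)

Section UpperBound.
Variable R : realType.

Definition clip (x : R) : R := Num.max 0 (Num.min 1 x).

Lemma clip01 x : 0 <= clip x <= 1.
Proof. by rewrite /clip maxEle minEle; case: ifP; case: ifP; lra. Qed.

(** Projection onto an interval does not increase the distance to its points. *)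
Lemma clip_sqr_le s x : 0 <= s <= 1 -> (clip x - s) ^+ 2 <= (x - s) ^+ 2.
Proof. by move=> s01; rewrite /clip maxEle minEle; case: ifP; case: ifP; nra. Qed.

Variable r : R.
Hypotheses (r_gt0 : 0 < r) (r_le_half : r <= 1 / 2).

(** [st.1] is the weight of the odd guess, of cost [(1 - v) / 2], and [st.2] that of the revealing
    mode of cost [v / 2]. Both follow importance-weighted gradients with learning rate [2 * r ^+ 4]:
    under [policy] the mean drifts before clipping are [r ^+ 4 * (2 * v - 1)] and
    [r ^+ 5 * (w - v)]. *)
Definition update (st : R * R) (o : 'I_7 * bool) : R * R :=
  match nat_of_ord o.1 with
  | 0 | 1 => st
  | 2 | 3 | 4 | 5 =>
    if o.2 then (clip (st.1 + r ^+ 3), clip (st.2 - r ^+ 4))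
    else (clip (st.1 - r ^+ 3), st.2)
  | _ => if o.2 then (st.1, clip (st.2 + r ^+ 2)) else st
  end.

Definition state (h : history 7 bool) : R * R := foldl update (1 / 2, 1 / 2) h.

Definition policy (st : R * R) : {ffun 'I_7 -> R} :=
  [ffun a : 'I_7 => match nat_of_ord a with
    | 0 => (1 - r - r ^+ 3) * (1 - st.1)
    | 1 => (1 - r - r ^+ 3) * st.1
    | 2 => r * st.2 * (1 - st.1)
    | 3 => r * st.2 * st.1
    | 4 => r * (1 - st.2) * (1 - st.1)
    | 5 => r * (1 - st.2) * st.1
    | _ => r ^+ 3
    end].

Definition ogd_learner (h : history 7 bool) := policy (state h).

Lemma r3_bounds : 0 < r ^+ 3 <= 1 / 8.
Proof.
rewrite exprn_gt0 //=.
have -> : 1 / 8 = (1 / 2) ^+ 3 :> R by field.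
by rewrite lerXn2r // nnegrE ?divr_ge0 ?ltW.
Qed.

Lemma state01 h : 0 <= (state h).1 <= 1 /\ 0 <= (state h).2 <= 1.
Proof.
elim/last_ind: h => [|h [a s] [IH1 IH2]]; first by rewrite /=; lra.
rewrite /state foldl_rcons -/(state h).
by elim/ord7_ind: a; rewrite /update /= inordK //; case: s; rewrite /= ?clip01.
Qed.

Lemma valid_ogd_learner : valid_learner ogd_learner.
Proof.
have rh := r_le_half.
move=> h; have [b01 c01] := state01 h; have r3 := r3_bounds.
rewrite /ogd_learner /policy; split=> [a|].
  have r0 := ltW r_gt0; have r30 : 0 <= r ^+ 3 by lra.
  have q0 : 0 <= 1 - r - r ^+ 3 by lra.
  have [b0 b1] : 0 <= (state h).1 /\ 0 <= 1 - (state h).1 by lra.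
  have [c0 c1] : 0 <= (state h).2 /\ 0 <= 1 - (state h).2 by lra.
  by rewrite ffunE; elim/ord7_ind: a; rewrite inordK // !mulr_ge0.
by rewrite sum_ord7 !ffunE !inordK //; ring.
Qed.

(** * Potential analysis of the gradient descent *)

Section Potential.
Variables bs cs : R.
Hypotheses (bs01 : 0 <= bs <= 1) (cs01 : 0 <= cs <= 1).

(** Squared distance to the comparator [(bs, cs)] over twice the learning rate. *)
Definition potential (st : R * R) : R :=
  ((st.1 - bs) ^+ 2 + (st.2 - cs) ^+ 2) / (4 * r ^+ 4).

(* [star] is the minimum of these affine functions over [bs, cs] in [{0, 1}]. *)
Definition linearized_star (v w : R) : R :=
  (w + cs * (v - w) + (v + bs * (1 - 2 * v))) / 2.

Lemma potential_le (st : R * R) (b c : R) : (st.1 - bs) ^+ 2 <= (b - bs) ^+ 2 ->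
  (st.2 - cs) ^+ 2 <= (c - cs) ^+ 2 -> potential st <= potential (b, c).
Proof.
move=> hb hc; rewrite /potential ler_wpM2r ?lerD //.
by rewrite invr_ge0 mulr_ge0 // exprn_ge0 // ltW.
Qed.

(** Once the projection is dropped, expanding the squares gives equality. The factor [r] is the
    probability of revealing the first bit. *)
Lemma potential_coin_true (b c : R) :
  r * potential (clip (b + r ^+ 3), clip (c - r ^+ 4)) <=
  r * potential (b, c) + (b - bs) / 2 + r ^+ 3 / 4
    - r * (c - cs) / 2 + r ^+ 5 / 4.
Proof.
apply: le_trans (_ : r * potential (b + r ^+ 3, c - r ^+ 4) <= _).
  by rewrite ler_pM2l // potential_le //= clip_sqr_le.
rewrite le_eqVlt; apply/orP; left; apply/eqP; rewrite /potential /=.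
by field; rewrite gt_eqF.
Qed.

Lemma potential_coin_false (b c : R) :
  r * potential (clip (b - r ^+ 3), c) <=
  r * potential (b, c) - (b - bs) / 2 + r ^+ 3 / 4.
Proof.
apply: le_trans (_ : r * potential (b - r ^+ 3, c) <= _).
  by rewrite ler_pM2l // potential_le //= clip_sqr_le.
rewrite le_eqVlt; apply/orP; left; apply/eqP; rewrite /potential /=.
by field; rewrite gt_eqF.
Qed.

Lemma potential_full_true (b c : R) :
  r ^+ 3 * potential (b, clip (c + r ^+ 2)) <=
  r ^+ 3 * potential (b, c) + r * (c - cs) / 2 + r ^+ 3 / 4.
Proof.
apply: le_trans (_ : r ^+ 3 * potential (b, c + r ^+ 2) <= _).
  by rewrite ler_pM2l ?exprn_gt0 // potential_le //= clip_sqr_le.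
rewrite le_eqVlt; apply/orP; left; apply/eqP; rewrite /potential /=.
by field; rewrite gt_eqF.
Qed.

Lemma min_le_convex (v w : R) : Num.min v w <= w + cs * (v - w).
Proof. by have cs1 := cs01; rewrite minEle; case: ifP; nra. Qed.

(** The linear terms of the drift cancel the excess of the guess and of the mode over the
    comparator, and the hiding mode is compared through [min_le_convex]. What remains is [r ^+ 3]
    for the seventh action and at most [3 / 4 * r ^+ 3] of second-order terms. *)
Lemma policy_step (st : R * R) (v w : R) : 0 <= v <= 1 -> 0 <= w <= 1 ->
  0 <= st.1 <= 1 -> 0 <= st.2 <= 1 ->
  \sum_a policy st a * (worst_loss a v w +
    (signal_prob a v w * potential (update st (a, true)) +
     (1 - signal_prob a v w) * potential (update st (a, false)))) <=
  linearized_star v w + 2 * r ^+ 3 + potential st.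
Proof.
have r0 := r_gt0; have rh := r_le_half; have cs1 := cs01; have bs1 := bs01.
case: st => b c /= v01 w01 b01 c01.
rewrite sum_ord7 /update /worst_loss /signal_prob !ffunE /= !inordK //=.
have := potential_coin_true b c; have := potential_coin_false b c.
have := potential_full_true b c; rewrite /linearized_star.
set P := potential (b, c); set Pt := potential _; set Pf := potential _.
set Pg := potential _; move: Pt Pf Pg P => Pt Pf Pg P ht hf hg.
have [r3 r38] := andP r3_bounds.
have r5 : r ^+ 5 <= r ^+ 3.
  by rewrite -[5%N]/(3 + 2)%N exprD -[leRHS]mulr1 ler_pM2l // expr_le1 //; lra.
have r50 : 0 < r ^+ 5 by rewrite exprn_gt0.
have := min_le_convex v w; set mn := Num.min v w => hm.
have mn0 : 0 <= mn by rewrite /mn minEle; case: ifP; lra.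
have hm' : (1 - r) * mn <= (1 - r) * (w + cs * (v - w)) by rewrite ler_wpM2l //; lra.
have h0 : 0 <= r ^+ 3 * (mn + (v * (1 - b) + (1 - v) * b)).
  by rewrite mulr_ge0 ?(ltW r3) // addr_ge0 //; nra.
have [[v0 v1] [w0 w1]] := (andP v01, andP w01).
have hgv := ler_wpM2l v0 hg; have htw := ler_wpM2l w0 ht.
have v1' : 0 <= 1 - v by lra.
have hfv := ler_wpM2l v1' hf; have h5 := mulr_ge0 v1' (ltW r50).
have w1' : 0 <= 1 - w by lra.
have h3 := mulr_ge0 w1' (ltW r3).
lra.
Qed.

Lemma expV_ogd_learner xs m t h :
  (forall i, (t <= i < t + m)%N -> simplex (xs i)) ->
  expV (game_loss R) game_signal ogd_learner xs m t h <=
  \sum_(t <= i < t + m) linearized_star (prob1 (xs i)) (prob2 (xs i)) +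
  m%:R * (2 * r ^+ 3) + potential (state h).
Proof.
elim: m t h => [|m IH] t h vx.
  rewrite addn0 big_geq // mul0r !add0r /=.
  rewrite /potential divr_ge0 ?addr_ge0 ?sqr_ge0 //.
  by rewrite mulr_ge0 // exprn_ge0 // ltW.
have sx : simplex (xs t) by apply: vx; rewrite leqnn addnS ltnS leq_addr.
have spi := valid_ogd_learner h.
rewrite expV_succ // big_ltn ?addnS ?ltnS ?leq_addr // -addSn.
set S := \sum_(t.+1 <= i < _) _; set V := prob1 _; set W := prob2 _.
set C := S + m%:R * (2 * r ^+ 3).
have IHm s : expV (game_loss R) game_signal ogd_learner xs m t.+1 (rcons h s)
    <= C + potential (update (state h) s).
  rewrite /state -foldl_rcons; apply: IH => i /andP[ti im]; apply: vx.
  by rewrite (ltnW ti) addnS -addSn.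
have [b01 c01] := state01 h.
have v01 := prob1_bounds sx; have w01 := prob2_bounds sx.
have step := policy_step v01 w01 b01 c01.
apply: le_trans (_ : \sum_a ogd_learner h a * (worst_loss a V W +
    (signal_prob a V W * potential (update (state h) (a, true)) +
     (1 - signal_prob a V W) * potential (update (state h) (a, false)))) + C <= _);
  last first.
  by move: step; rewrite -/V -/W -natr1 /ogd_learner /C; lra.
case: (spi) => pi0 pi1.
rewrite -[X in _ <= _ + X]mul1r -[X in _ <= _ + X * _]pi1 big_distrl -big_split /=.
apply: ler_sum => a _; rewrite -mulrDr ler_wpM2l //.
have := IHm (a, true); have := IHm (a, false).
have : 0 <= signal_prob a V W <= 1.
  by move: a; elim/ord7_ind; rewrite /signal_prob inordK //=; lra.
nra.
Qed.

Lemma sum_linearized_star (v w : nat -> R) n :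
  \sum_(0 <= i < n) linearized_star (v i) (w i) =
  ((1 - cs) * \sum_(i < n) w i + (1 + cs - 2 * bs) * \sum_(i < n) v i
   + n%:R * bs) / 2.
Proof.
elim: n => [|n IH]; first by rewrite big_geq // !big_ord0; field.
by rewrite big_nat_recr // IH !big_ord_recr -natr1 /linearized_star /=; field.
Qed.

End Potential.

Lemma regret_ogd_learner n xs : (0 < n)%N -> n%:R * r ^+ 7 = 1 ->
  valid_adversary n xs ->
  regret (game_loss R) game_signal n ogd_learner xs <= 3 / r ^+ 4.
Proof.
move=> n0 nr vx; have sa := simplex_avgx n0 vx.
rewrite /regret Vstar_game //.
set v := prob1 _; set w := prob2 _.
have nv : n%:R * v = \sum_(i < n) prob1 (xs i).
  rewrite /v /prob1 !ffunE -mulrDr mulrA divff ?mul1r -?big_split //.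
  by rewrite pnatr_eq0 -lt0n.
have nw : n%:R * w = \sum_(i < n) prob2 (xs i).
  rewrite /w /prob2 !ffunE -mulrDr mulrA divff ?mul1r -?big_split //.
  by rewrite pnatr_eq0 -lt0n.
(* The comparator attains both minima in [star] at the average marginals. As [linearized_star] is
   affine in them, its sum over the rounds is exactly [n * star]. *)
pose cs : R := if v <= w then 1 else 0.
pose bs : R := if v <= 1 - v then 0 else 1.
have cs01 : 0 <= cs <= 1 by rewrite /cs; case: ifP; lra.
have bs01 : 0 <= bs <= 1 by rewrite /bs; case: ifP; lra.
have lin : n%:R * star v w = \sum_(0 <= i < n)
    linearized_star bs cs (prob1 (xs i)) (prob2 (xs i)).
  rewrite sum_linearized_star -nv -nw /star /bs /cs minEle [Num.min v (1 - v)]minEle.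
  by case: ifP; case: ifP => _ _; field.
have := @expV_ogd_learner bs cs bs01 cs01 xs n 0 [::]; rewrite add0n -lin.
move=> /(_ vx) H; rewrite lerBlDl (le_trans H) // -addrA lerD2l.
have r0 : r != 0 by rewrite gt_eqF.
have -> : n%:R = 1 / r ^+ 7 :> R by rewrite -[LHS](mulfK (expf_neq0 7 r0)) nr.
(* The overhead of all rounds is [2 / r ^+ 4]; the initial potential is [1 / (8 * r ^+ 4)], both
   coordinates starting at distance [1 / 2] from the comparator. *)
have -> : 1 / r ^+ 7 * (2 * r ^+ 3) = 2 / r ^+ 4 by field.
have -> : 3 / r ^+ 4 = 2 / r ^+ 4 + 1 / r ^+ 4 by field.
rewrite lerD2l /potential /=.
have -> : (1 / 2 - bs) ^+ 2 = 1 / 4 by rewrite /bs; case: ifP => _; field.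
have -> : (1 / 2 - cs) ^+ 2 = 1 / 4 by rewrite /cs; case: ifP => _; field.
have -> : (1 / 4 + 1 / 4) / (4 * r ^+ 4) = (1 / 8) * (1 / r ^+ 4) by field.
have : 0 < 1 / r ^+ 4 by rewrite divr_gt0 // exprn_gt0.
lra.
Qed.

End UpperBound.

(** * Lower bound *)

Section LowerBound.
Variable R : realType.

(* Expectation over independent signs with means [alpha] and [beta]. *)
Definition mix (alpha beta : R) (G : R -> R -> R) : R :=
  ((1 + alpha) * (1 + beta) * G 1 1 + (1 + alpha) * (1 - beta) * G 1 (- 1) +
   (1 - alpha) * (1 + beta) * G (- 1) 1 +
   (1 - alpha) * (1 - beta) * G (- 1) (- 1)) / 4.

Lemma mixD alpha beta G1 G2 :
  mix alpha beta (fun s t => G1 s t + G2 s t) = mix alpha beta G1 + mix alpha beta G2.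
Proof. by rewrite /mix; field. Qed.

Lemma mixZ alpha beta k G : mix alpha beta (fun s t => k * G s t) = k * mix alpha beta G.
Proof. by rewrite /mix; field. Qed.

Lemma mix_sum (T : finType) alpha beta (p : T -> R) (G : T -> R -> R -> R) :
  mix alpha beta (fun s t => \sum_a p a * G a s t) = \sum_a p a * mix alpha beta (G a).
Proof.
under [RHS]eq_bigr do rewrite -mixZ.
by rewrite /mix !big_distrr -!big_split big_distrl.
Qed.

Lemma ler_mix (alpha beta : R) G1 G2 : -1 <= alpha <= 1 -> -1 <= beta <= 1 ->
  (forall s t, (s = 1) \/ (s = - 1) -> (t = 1) \/ (t = - 1) -> G1 s t <= G2 s t) ->
  mix alpha beta G1 <= mix alpha beta G2.
Proof.
move=> /andP[a0 a1] /andP[b0 b1] G12; rewrite /mix ler_wpM2r ?invr_ge0 //.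
have [a0' a1'] : 0 <= 1 + alpha /\ 0 <= 1 - alpha by lra.
have [b0' b1'] : 0 <= 1 + beta /\ 0 <= 1 - beta by lra.
by do !apply: lerD; apply: ler_wpM2l; rewrite ?mulr_ge0 //; apply: G12; auto.
Qed.

(* Posterior mean of a sign [s] of prior mean [alpha] after an event of
   likelihood [(1 + s * delta) / 2]. *)
Definition posterior (alpha delta : R) : R := (alpha + delta) / (1 + delta * alpha).

Lemma correlation_gt0 (alpha delta : R) : -1 <= alpha <= 1 -> -1 < delta < 1 ->
  0 < 1 + delta * alpha.
Proof.
move=> /andP[a0 a1] /andP[d0 d1].
have [d0' d1'] : 0 < 1 + delta /\ 0 < 1 - delta by lra.
have [alpha0|alpha0|->] := ltrgtP alpha 0; last by lra.
  have : alpha * (1 - delta) < 0 by rewrite pmulr_llt0.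
  lra.
by have := mulr_gt0 alpha0 d0'; lra.
Qed.

Lemma posterior_bounds (alpha delta : R) : -1 <= alpha <= 1 -> -1 < delta < 1 ->
  -1 <= posterior alpha delta <= 1.
Proof.
move=> a1 d1; have pos := correlation_gt0 a1 d1.
have h1 : 0 <= (1 - alpha) * (1 - delta) by rewrite mulr_ge0; lra.
have h2 : 0 <= (1 + alpha) * (1 + delta) by rewrite mulr_ge0; lra.
by rewrite /posterior ler_pdivrMr // ler_pdivlMr //; lra.
Qed.

(** Limits what one signal of bias [delta] teaches. The gap between the two sides is an explicit
    fraction whose factors are all nonnegative. *)
Lemma posterior_second_moment (alpha delta : R) : -1 <= alpha <= 1 -> -1 < delta < 1 ->
  (1 + delta * alpha) / 2 * posterior alpha delta ^+ 2 +
  (1 - delta * alpha) / 2 * posterior alpha (- delta) ^+ 2 <= alpha ^+ 2 + delta ^+ 2.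
Proof.
move=> a1 d1; have pos := correlation_gt0 a1 d1.
have d1N : -1 < - delta < 1 by lra.
have := correlation_gt0 a1 d1N; rewrite mulNr => neg.
rewrite -subr_ge0 /posterior.
have -> : alpha ^+ 2 + delta ^+ 2 -
    ((1 + delta * alpha) / 2 * ((alpha + delta) / (1 + delta * alpha)) ^+ 2 +
     (1 - delta * alpha) / 2 * ((alpha - delta) / (1 + (- delta) * alpha)) ^+ 2) =
    delta ^+ 2 * alpha ^+ 2 * (2 - alpha ^+ 2 - delta ^+ 2) /
      ((1 + delta * alpha) * (1 - delta * alpha)).
  by field; rewrite !gt_eqF.
rewrite divr_ge0 //; last by rewrite mulr_ge0 ?ltW.
have h1 : 0 <= (1 - alpha) * (1 + alpha) by rewrite mulr_ge0; lra.
have h2 : 0 <= (1 - delta) * (1 + delta) by rewrite mulr_ge0; lra.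
have h3 : 0 <= delta ^+ 2 * alpha ^+ 2 by rewrite -exprMn sqr_ge0.
by rewrite (mulr_ge0 h3) //; lra.
Qed.

(** Bayes' rule: drawing the signs before the signal equals drawing the signal first and then the
    signs from the posterior. The signal depends on one sign only, so the posterior is again a
    product. *)
Lemma mix_bayes1 (alpha beta delta : R) G1 G0 : -1 <= alpha <= 1 -> -1 < delta < 1 ->
  mix alpha beta (fun s t => (1 + s * delta) / 2 * G1 s t + (1 - (1 + s * delta) / 2) * G0 s t) =
  (1 + delta * alpha) / 2 * mix (posterior alpha delta) beta G1 +
  (1 - delta * alpha) / 2 * mix (posterior alpha (- delta)) beta G0.
Proof.
move=> a1 d1; have pos := correlation_gt0 a1 d1.
have d1N : -1 < - delta < 1 by lra.
have := correlation_gt0 a1 d1N; rewrite mulNr => neg.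
by rewrite /mix /posterior; field; rewrite mulNr !gt_eqF.
Qed.

Lemma mix_bayes2 (alpha beta delta : R) G1 G0 : -1 <= beta <= 1 -> -1 < delta < 1 ->
  mix alpha beta (fun s t => (1 + t * delta) / 2 * G1 s t + (1 - (1 + t * delta) / 2) * G0 s t) =
  (1 + delta * beta) / 2 * mix alpha (posterior beta delta) G1 +
  (1 - delta * beta) / 2 * mix alpha (posterior beta (- delta)) G0.
Proof.
move=> a1 d1; have pos := correlation_gt0 a1 d1.
have d1N : -1 < - delta < 1 by lra.
have := correlation_gt0 a1 d1N; rewrite mulNr => neg.
by rewrite /mix /posterior; field; rewrite mulNr !gt_eqF.
Qed.

(** With weight 2 on [beta ^+ 2], positivity forces [beta ^+ 2 < 1 / 2]: the cheap revealing mode is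
    still in doubt, so revealing costs at least [c / 32] on average. *)
Definition uncertainty (alpha beta : R) : R :=
  Num.max 0 (1 - alpha ^+ 2 - 2 * beta ^+ 2).

Lemma uncertainty_ge0 alpha beta : 0 <= uncertainty alpha beta.
Proof. by rewrite /uncertainty le_max lexx. Qed.

Lemma uncertainty_ge alpha beta : 1 - alpha ^+ 2 - 2 * beta ^+ 2 <= uncertainty alpha beta.
Proof. by rewrite /uncertainty le_max lexx orbT. Qed.

(** * The stationary environments and their excess losses *)

Variables (n : nat) (eps c : R).
Hypotheses (eps_gt0 : 0 < eps) (eps_le : eps <= c / 2) (c_le : c <= 1 / 4).
(** Information costs at least its worth: over [n] rounds a look at the first bit is worth at most
    [eps ^+ 3 * n], against a price [c / 32], and a look at the second at most
    [2 * eps * c ^+ 2 * n], against [1 / 4]. *)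
Hypotheses (eps3 : 32 * eps ^+ 3 * n%:R <= c) (epsc : 8 * eps * c ^+ 2 * n%:R <= 1).

Definition env (s t : R) : {ffun bool * bool -> R} :=
  coupling (1 / 2 + s * eps) (1 / 2 + t * c).

Definition excess (a : 'I_7) (s t : R) : R :=
  worst_loss a (1 / 2 + s * eps) (1 / 2 + t * c) -
  star (1 / 2 + s * eps) (1 / 2 + t * c).

(** Affine in each sign, so that [mix] evaluates it at the means. The terms in [c] use
    [eps <= c / 2]: the dearer revealing mode costs at least [c / 4] extra. *)
Definition excess_lb (a : 'I_7) (s t : R) : R :=
  match nat_of_ord a with
  | 0 => eps * (1 + s) / 2
  | 1 => eps * (1 - s) / 2
  | 2 => eps * (1 + s) / 2 + c / 8 * (1 - t)
  | 3 => eps * (1 - s) / 2 + c / 8 * (1 - t)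
  | 4 => eps * (1 + s) / 2 + c / 8 * (1 + t)
  | 5 => eps * (1 - s) / 2 + c / 8 * (1 + t)
  | _ => 1 / 2
  end.

Lemma excess_lbP a (s t : R) : (s = 1) \/ (s = - 1) -> (t = 1) \/ (t = - 1) ->
  excess_lb a s t <= excess a s t.
Proof.
have e0 := eps_gt0; have e1 := eps_le; have c1 := c_le.
rewrite /excess /star minEle [Num.min _ (1 - _)]minEle.
elim/ord7_ind: a => -[] -> [] ->; rewrite /excess_lb /worst_loss inordK //= ?minEle;
  case: ifP; case: ifP; lra.
Qed.

(** Makes the bound independent of the guess and of the revealing mode, through
    [2 * (1 + x) >= 1 - x ^+ 2] for [x] equal to plus or minus [alpha] or [beta]. *)
Lemma mix_excess (alpha beta : R) a : -1 <= alpha <= 1 -> -1 <= beta <= 1 ->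
  eps / 4 * (1 - alpha ^+ 2) + (match nat_of_ord a with
    | 0 | 1 => 0 | 2 | 3 | 4 | 5 => c / 16 * (1 - beta ^+ 2) | _ => 1 / 4 end)
  <= mix alpha beta (excess a).
Proof.
move=> al be; have e0 := eps_gt0; have e1 := eps_le; have c1 := c_le.
apply: le_trans (ler_mix al be (@excess_lbP a)).
have [ha ha'] : 0 <= eps * (1 + alpha) ^+ 2 /\ 0 <= eps * (1 - alpha) ^+ 2.
  by split; rewrite (mulr_ge0 (ltW e0)) ?sqr_ge0.
have c0 : 0 <= c by lra.
have [hb hb'] : 0 <= c * (1 + beta) ^+ 2 /\ 0 <= c * (1 - beta) ^+ 2.
  by split; rewrite (mulr_ge0 c0) ?sqr_ge0.
have h6 : 0 <= eps * alpha ^+ 2 by rewrite (mulr_ge0 (ltW e0)) ?sqr_ge0.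
by elim/ord7_ind: a; rewrite /mix /excess_lb inordK //=; lra.
Qed.

(** * One round of the backward induction, by type of action *)

Section Step.
Variables (m : nat) (alpha beta X : R) (G1 G0 : R -> R -> R).
Hypotheses (mn : (m <= n)%N) (al : -1 <= alpha <= 1) (be : -1 <= beta <= 1).
Hypothesis H1 : forall alpha' beta', -1 <= alpha' <= 1 -> -1 <= beta' <= 1 ->
  eps / 4 * m%:R * uncertainty alpha' beta' <= mix alpha' beta' G1.
Hypothesis H0 : forall alpha' beta', -1 <= alpha' <= 1 -> -1 <= beta' <= 1 ->
  eps / 4 * m%:R * uncertainty alpha' beta' <= mix alpha' beta' G0.

Lemma uncertainty_le : uncertainty alpha beta <= 1 - alpha ^+ 2.
Proof.
have al2 : 0 <= (1 - alpha) * (1 + alpha) by rewrite mulr_ge0; have := al; lra.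
by rewrite /uncertainty ge_max; have := sqr_ge0 beta; lra.
Qed.

Lemma step_hidden : eps / 4 * (1 - alpha ^+ 2) + 0 <= X ->
  eps / 4 * (m%:R + 1) * uncertainty alpha beta <=
  X + mix alpha beta (fun s t => 1 * G1 s t + (1 - 1) * G0 s t).
Proof.
move=> ex; have -> : mix alpha beta (fun s t => 1 * G1 s t + (1 - 1) * G0 s t) =
  mix alpha beta G1 by rewrite /mix; field.
have e4 : 0 <= eps / 4 by rewrite divr_ge0 // ltW.
by have := H1 al be; have := ler_wpM2l e4 uncertainty_le; lra.
Qed.

(** [D] is the mean uncertainty after the signal, [loss] bounds its decrease and [bonus] is the
    price of the signal. If the uncertainty is already zero, nonnegativity suffices; otherwise
    [2 * beta ^+ 2 <= 1] and the price covers the loss. *)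
Lemma step_informed Y D loss bonus :
  eps / 4 * (1 - alpha ^+ 2) + bonus <= X -> eps / 4 * m%:R * D <= Y ->
  0 <= D -> 0 <= bonus -> 1 - alpha ^+ 2 - 2 * beta ^+ 2 - loss <= D ->
  (2 * beta ^+ 2 <= 1 -> eps / 4 * m%:R * loss <= bonus) ->
  eps / 4 * (m%:R + 1) * uncertainty alpha beta <= X + Y.
Proof.
move=> ex hY D0 b0 hD hb.
have e4 : 0 <= eps / 4 by rewrite divr_ge0 // ltW.
have k0 : 0 <= eps / 4 * m%:R by rewrite mulr_ge0.
have := ler_wpM2l e4 uncertainty_le; have := ler_wpM2l k0 hD.
have := mulr_ge0 k0 D0; rewrite /uncertainty maxEle; case: ifP => [psi0|_].
  move=> _ h1 h2; have hb' : 2 * beta ^+ 2 <= 1 by have := sqr_ge0 alpha; lra.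
  by have := hb hb'; lra.
by have := sqr_ge0 alpha; lra.
Qed.

(** The signal has bias [2 * eps] and moves only [alpha], so the loss is at most
    [(2 * eps) ^+ 2]. *)
Lemma step_first : eps / 4 * (1 - alpha ^+ 2) + c / 16 * (1 - beta ^+ 2) <= X ->
  eps / 4 * (m%:R + 1) * uncertainty alpha beta <=
  X + mix alpha beta (fun s t => (1 / 2 + s * eps) * G1 s t +
                                 (1 - (1 / 2 + s * eps)) * G0 s t).
Proof.
move=> ex; have e0 := eps_gt0; have e1 := eps_le; have c1 := c_le.
have d1 : -1 < 2 * eps < 1 by lra.
have d1N : -1 < - (2 * eps) < 1 by lra.
have -> : mix alpha beta (fun s t => (1 / 2 + s * eps) * G1 s t +
    (1 - (1 / 2 + s * eps)) * G0 s t) =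
  (1 + 2 * eps * alpha) / 2 * mix (posterior alpha (2 * eps)) beta G1 +
  (1 - 2 * eps * alpha) / 2 * mix (posterior alpha (- (2 * eps))) beta G0.
  by rewrite -(mix_bayes1 _ _ _ al d1) /mix; field.
have := posterior_second_moment al d1.
have := correlation_gt0 al d1; have := correlation_gt0 al d1N; rewrite mulNr.
have := H1 (posterior_bounds al d1) be; have := H0 (posterior_bounds al d1N) be.
set a0 := posterior _ (- _); set a1 := posterior _ _.
set U1 := uncertainty a1 _; set U0 := uncertainty a0 _.
set q1 := (1 + 2 * eps * alpha); set q0 := (1 - 2 * eps * alpha).
move=> h0 h1 q0p q1p mom.
have [q0h q1h] : 0 <= q0 / 2 /\ 0 <= q1 / 2 by lra.
have g0 := ler_wpM2l q0h h0; have g1 := ler_wpM2l q1h h1.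
have u1 := ler_wpM2l q1h (uncertainty_ge a1 beta).
have u0 := ler_wpM2l q0h (uncertainty_ge a0 beta).
have qq : q1 + q0 = 2 by rewrite /q1 /q0; ring.
have be2 : 0 <= (1 - beta) * (1 + beta) by rewrite mulr_ge0; have := be; lra.
have c0 : 0 <= c / 16 by lra.
have mR : (m%:R : R) <= n%:R by rewrite ler_nat.
apply: (step_informed (D := q1 / 2 * U1 + q0 / 2 * U0) (loss := (2 * eps) ^+ 2) ex).
- by lra.
- by rewrite addr_ge0 // mulr_ge0 // uncertainty_ge0.
- by have := mulr_ge0 c0 be2; lra.
- have -> : 1 - alpha ^+ 2 - 2 * beta ^+ 2 = (q1 + q0) / 2 * (1 - 2 * beta ^+ 2) - alpha ^+ 2.
    by rewrite qq; field.
  by move: u1 u0; rewrite -/U1 -/U0; lra.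
move=> b2; have e3 : 0 <= eps ^+ 3 by rewrite exprn_ge0 // ltW.
have := ler_wpM2l e3 mR; have := eps3.
have b2' : 0 <= 1 - 2 * beta ^+ 2 by lra.
by have := mulr_ge0 c0 b2'; lra.
Qed.

(** The signal has bias [2 * c] and moves only [beta]; the weight 2 in [uncertainty] doubles the
    loss. *)
Lemma step_second : eps / 4 * (1 - alpha ^+ 2) + 1 / 4 <= X ->
  eps / 4 * (m%:R + 1) * uncertainty alpha beta <=
  X + mix alpha beta (fun s t => (1 / 2 + t * c) * G1 s t +
                                 (1 - (1 / 2 + t * c)) * G0 s t).
Proof.
move=> ex; have e0 := eps_gt0; have e1 := eps_le; have c1 := c_le.
have d1 : -1 < 2 * c < 1 by lra.
have d1N : -1 < - (2 * c) < 1 by lra.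
have -> : mix alpha beta (fun s t => (1 / 2 + t * c) * G1 s t +
    (1 - (1 / 2 + t * c)) * G0 s t) =
  (1 + 2 * c * beta) / 2 * mix alpha (posterior beta (2 * c)) G1 +
  (1 - 2 * c * beta) / 2 * mix alpha (posterior beta (- (2 * c))) G0.
  by rewrite -(mix_bayes2 _ _ _ be d1) /mix; field.
have := posterior_second_moment be d1.
have := correlation_gt0 be d1; have := correlation_gt0 be d1N; rewrite mulNr.
have := H1 al (posterior_bounds be d1); have := H0 al (posterior_bounds be d1N).
set b0 := posterior _ (- _); set b1 := posterior _ _.
set U1 := uncertainty _ b1; set U0 := uncertainty _ b0.
set q1 := (1 + 2 * c * beta); set q0 := (1 - 2 * c * beta).
move=> h0 h1 q0p q1p mom.
have [q0h q1h] : 0 <= q0 / 2 /\ 0 <= q1 / 2 by lra.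
have g0 := ler_wpM2l q0h h0; have g1 := ler_wpM2l q1h h1.
have u1 := ler_wpM2l q1h (uncertainty_ge alpha b1).
have u0 := ler_wpM2l q0h (uncertainty_ge alpha b0).
have qq : q1 + q0 = 2 by rewrite /q1 /q0; ring.
have mR : (m%:R : R) <= n%:R by rewrite ler_nat.
apply: (step_informed (D := q1 / 2 * U1 + q0 / 2 * U0) (loss := 2 * (2 * c) ^+ 2) ex).
- by lra.
- by rewrite addr_ge0 // mulr_ge0 // uncertainty_ge0.
- by lra.
- have -> : 1 - alpha ^+ 2 - 2 * beta ^+ 2 = (q1 + q0) / 2 * (1 - alpha ^+ 2) - 2 * beta ^+ 2.
    by rewrite qq; field.
  by move: u1 u0; rewrite -/U1 -/U0; lra.
move=> _; have c3 : 0 <= eps * c ^+ 2 by rewrite mulr_ge0 ?exprn_ge0 //; lra.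
by have := ler_wpM2l c3 mR; have := epsc; lra.
Qed.

End Step.

(** * Backward induction against an arbitrary learner *)

Variable lr : learner R 7 bool.
Hypothesis valid_lr : valid_learner lr.

Definition env_regret (m i : nat) (h : history 7 bool) (s t : R) : R :=
  expV (game_loss R) game_signal lr (fun=> env s t) m i h -
  m%:R * star (1 / 2 + s * eps) (1 / 2 + t * c).

Lemma simplex_env (s t : R) : (s = 1) \/ (s = - 1) -> (t = 1) \/ (t = - 1) ->
  simplex (env s t).
Proof.
have e0 := eps_gt0; have e1 := eps_le; have c1 := c_le.
by case=> -> [] ->; apply: simplex_coupling; lra.
Qed.

Lemma env_regret_succ m i h (s t : R) :
  (s = 1) \/ (s = - 1) -> (t = 1) \/ (t = - 1) ->
  let P a := signal_prob a (1 / 2 + s * eps) (1 / 2 + t * c) in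
  env_regret m.+1 i h s t = \sum_a lr h a * (excess a s t +
    (P a * env_regret m i.+1 (rcons h (a, true)) s t +
     (1 - P a) * env_regret m i.+1 (rcons h (a, false)) s t)).
Proof.
move=> hs ht P; have se := simplex_env hs ht.
rewrite /env_regret expV_succ // coupling_prob1 coupling_prob2.
set st := star _ _; case: (valid_lr h) => _ l1.
apply/eqP; rewrite subr_eq; apply/eqP.
have -> : m.+1%:R * st = \sum_a lr h a * (m.+1%:R * st).
  by rewrite -big_distrl l1 /= mul1r.
rewrite -big_split /=; apply: eq_bigr => a _; rewrite -mulrDr /excess -natr1 -/st /P.
ring.
Qed.

(** The means are arbitrary and not tied to [h], so the induction hypothesis applies directly at the
    posterior means after one more signal. *)
Lemma mix_env_regret_ge m i h (alpha beta : R) : (m <= n)%N ->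
  -1 <= alpha <= 1 -> -1 <= beta <= 1 ->
  eps / 4 * m%:R * uncertainty alpha beta <= mix alpha beta (env_regret m i h).
Proof.
have e0 := eps_gt0; have e1 := eps_le; have c1 := c_le.
elim: m i h alpha beta => [|m IH] i h alpha beta mn al be.
  by rewrite mulr0 mul0r /mix /env_regret /=; lra.
apply: (@le_trans _ _ (mix alpha beta (fun s t => \sum_a lr h a * (excess a s t +
    (signal_prob a (1 / 2 + s * eps) (1 / 2 + t * c) * env_regret m i.+1 (rcons h (a, true)) s t +
     (1 - signal_prob a (1 / 2 + s * eps) (1 / 2 + t * c)) * env_regret m i.+1 (rcons h (a, false)) s t)))));
  last by apply: ler_mix => // s t hs ht; rewrite env_regret_succ.
rewrite mix_sum; apply: simplex_sum_ge => // a; rewrite mixD -[m.+1%:R]natr1.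
have mn' := ltnW mn; have ex := mix_excess a al be.
have IHm g alpha' beta' := IH i.+1 (rcons h (a, g)) alpha' beta' mn'.
move: (env_regret m i.+1 (rcons h (a, true))) (IHm true)
  (env_regret m i.+1 (rcons h (a, false))) (IHm false) => G1 H1 G0 H0.
elim/ord7_ind: a ex {IHm}; rewrite /signal_prob inordK //= => ex.
- exact: (step_hidden _ al be H1 ex).
- exact: (step_hidden _ al be H1 ex).
- exact: (step_first mn' al be H1 H0 ex).
- exact: (step_first mn' al be H1 H0 ex).
- exact: (step_first mn' al be H1 H0 ex).
- exact: (step_first mn' al be H1 H0 ex).
- exact: (step_second mn' al be H1 H0 ex).
Qed.

Lemma regret_env s t : (0 < n)%N ->
  (s = 1) \/ (s = - 1) -> (t = 1) \/ (t = - 1) ->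
  regret (game_loss R) game_signal n lr (fun=> env s t) = env_regret n 0 [::] s t.
Proof.
move=> n0 hs ht; have se := simplex_env hs ht; rewrite /regret /env_regret.
have -> : avgx n (fun=> env s t) = env s t.
  apply/ffunP => z; rewrite [LHS]ffunE sumr_const card_ord -[X in _ * X]mulr_natl.
  by rewrite mulKf // pnatr_eq0 -lt0n.
by rewrite Vstar_game // coupling_prob1 coupling_prob2.
Qed.

Lemma exists_regret_ge : (0 < n)%N -> exists2 xs, valid_adversary n xs &
  eps / 4 * n%:R <= regret (game_loss R) game_signal n lr xs.
Proof.
(* Uniform signs: the average of the four regrets reaches the bound, hence one of them does. *)
move=> n0; have z1 : -1 <= (0 : R) <= 1 by lra.
have := mix_env_regret_ge 0 [::] (leqnn n) z1 z1.
have -> : uncertainty 0 0 = 1.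
  by rewrite /uncertainty expr0n /= mulr0 !subr0 maxEle ler01.
rewrite mulr1 /mix; set B := eps / 4 * _ => avgB.
have s1 : (1 = 1 :> R) \/ (1 = - 1 :> R) by left.
have sN1 : (- 1 = 1 :> R) \/ (- 1 = - 1 :> R) by right.
have wit s t (hs : (s = 1) \/ (s = - 1)) (ht : (t = 1) \/ (t = - 1)) :
    B <= env_regret n 0 [::] s t -> exists2 xs, valid_adversary n xs &
    B <= regret (game_loss R) game_signal n lr xs.
  move=> Bst; exists (fun=> env s t); last by rewrite regret_env.
  by move=> i _; apply: simplex_env.
have [/wit|h1] := lerP B (env_regret n 0 [::] 1 1); first exact.
have [/wit|h2] := lerP B (env_regret n 0 [::] 1 (- 1)); first exact.
have [/wit|h3] := lerP B (env_regret n 0 [::] (- 1) 1); first exact.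
have [/wit|h4] := lerP B (env_regret n 0 [::] (- 1) (- 1)); first exact.
by lra.
Qed.

End LowerBound.

(** * The rate *)

Section Rate.
Variable R : realType.

Lemma minimax_regret_bounds n (r : R) : (0 < n)%N -> 0 < r -> r <= 1 / 2 ->
  n%:R * r ^+ 7 = 1 ->
  1 / 32 / r ^+ 4 <= minimax_regret (game_loss R) game_signal n <= 3 / r ^+ 4.
Proof.
move=> n0 r0 rh nr.
have rn0 : r != 0 by rewrite gt_eqF.
have en : n%:R = 1 / r ^+ 7 :> R by rewrite -[LHS](mulfK (expf_neq0 7 rn0)) nr.
have r2 : r ^+ 2 <= 1 / 4 by rewrite expr2; nra.
have r30 : 0 < r ^+ 3 by rewrite exprn_gt0.
have adv lr : valid_learner lr -> exists2 xs, valid_adversary n xs &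
    1 / 32 / r ^+ 4 <= regret (game_loss R) game_signal n lr xs.
  move=> vl; have -> : 1 / 32 / r ^+ 4 = (r ^+ 3 / 8) / 4 * n%:R.
    by rewrite en; field.
  (* For these values [epsc] is an equality, as [n * r ^+ 7 = 1]. *)
  apply: (@exists_regret_ge R n (r ^+ 3 / 8) (r ^+ 2)) => //; first by lra.
  - by rewrite exprSr; have := sqr_ge0 r; nra.
  - rewrite en; have -> : 32 * (r ^+ 3 / 8) ^+ 3 * (1 / r ^+ 7) = r ^+ 2 / 16 by field.
    by have := sqr_ge0 r; lra.
  - by rewrite en le_eqVlt; apply/orP; left; apply/eqP; field.
set worst := fun lr => sup [set regret (game_loss R) game_signal n lr xs
  | xs in [set xs | valid_adversary n xs]]%classic.
have worst_ge lr : valid_learner lr -> 1 / 32 / r ^+ 4 <= worst lr.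
  move=> vl; have [xs vx hx] := adv lr vl; apply: (le_trans hx).
  apply: ub_le_sup; last by exists xs.
  by exists n%:R => _ [ys vy <-]; apply: regret_le.
have vl := valid_ogd_learner r0 rh.
apply/andP; split.
  apply: lb_le_inf; first by exists (worst (ogd_learner r)); exists (ogd_learner r).
  by move=> _ [lr vlr <-]; apply: worst_ge.
apply: (@le_trans _ _ (worst (ogd_learner r))).
  apply: ge_inf; last by exists (ogd_learner r).
  by exists (1 / 32 / r ^+ 4) => _ [lr vlr <-]; apply: worst_ge.
have [xs vx _] := adv _ vl.
apply: ge_sup; first by exists (regret (game_loss R) game_signal n (ogd_learner r) xs); exists xs.
by move=> _ [ys vy <-]; apply: regret_ogd_learner.
Qed.

Lemma ln_minimax_regret_bounds n : (128 <= n)%N ->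
  4 / 7 + ln (1 / 32) / ln n%:R <=
  ln (minimax_regret (game_loss R) game_signal n) / ln (n%:R : R) <=
  4 / 7 + ln 3 / ln n%:R.
Proof.
move=> n128; have n0 : (0 < n)%N by apply: leq_trans n128.
have nR0 : 0 < n%:R :> R by rewrite ltr0n.
have nR1 : 1 < n%:R :> R by rewrite ltr1n; apply: leq_trans n128.
have lnn : 0 < ln n%:R :> R by rewrite ln_gt0.
pose r : R := n%:R `^ (- (1 / 7)).
have r0 : 0 < r by rewrite powR_gt0.
have rX k : r ^+ k = n%:R `^ (- (k%:R / 7)).
  by rewrite -powR_mulrn ?ltW // -powRrM; congr (_ `^ _); field.
have nr : n%:R * r ^+ 7 = 1.
  rewrite rX divff // powRN powRr1 ?ltW // divff //.
  by rewrite gt_eqF.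
(* The threshold 128 is [2 ^ 7], so that [r ^+ 7 = 1 / n] is at most [(1 / 2) ^+ 7]. *)
have rh : r <= 1 / 2.
  rewrite leNgt; apply/negP => hr.
  have : (1 / 2) ^+ 7 < r ^+ 7 by rewrite ltrXn2r //= ?nnegrE ?divr_ge0 ?ltW.
  have n128R : 128 <= n%:R :> R by rewrite ler_nat.
  have r70 : 0 < r ^+ 7 by rewrite exprn_gt0.
  have -> : (1 / 2) ^+ 7 = 1 / 128 :> R by field.
  by have := ler_wpM2r (ltW r70) n128R; rewrite nr; lra.
have r4 : 0 < r ^+ 4 by rewrite exprn_gt0.
have lnr4 : ln (r ^+ 4) = - (4 / 7) * ln n%:R by rewrite rX ln_powR.
have [lo hi] := andP (minimax_regret_bounds n0 r0 rh nr).
have lo0 : 0 < 1 / 32 / r ^+ 4 by rewrite !divr_gt0.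
have mm0 := lt_le_trans lo0 lo.
have hi0 : 0 < 3 / r ^+ 4 by rewrite divr_gt0.
have lo' := lo; rewrite -ler_ln ?posrE // ln_div ?posrE ?divr_gt0 // lnr4 in lo'.
have hi' := hi; rewrite -ler_ln ?posrE // ln_div ?posrE // lnr4 in hi'.
rewrite ler_pdivlMr // ler_pdivrMr // !mulrDl !divfK ?gt_eqF //.
by apply/andP; split; lra.
Qed.

Lemma cvg_div_ln_nat (c : R) :
  (4 / 7 + c / ln (n%:R : R) @[n --> \oo] --> (4 / 7 : R))%classic.
Proof.
rewrite -[X in (_ --> X)%classic]addr0; apply: cvgD; first exact: cvg_cst.
rewrite -[X in (_ --> X)%classic](mulr0 c); apply: cvgMr.
have ln_pos : (\forall n \near \oo, 0 < ln (n%:R : R))%classic.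
  by exists 2%N => // n /= n2; rewrite ln_gt0 // ltr1n.
apply/(gtr0_cvgV0 ln_pos); apply/cvgryPge => A.
near=> n; rewrite -[A]expRK ler_ln ?posrE ?expR_gt0 //.
  by near: n; apply: nbhs_infty_ger.
by rewrite ltr0n; near: n; exists 1%N.
Unshelve. all: by end_near. Qed.

End Rate.

Theorem theorem3 (R : realType) :
  exists (k : nat) (Z Sigma : finType) (L : 'I_k -> Z -> R) (S : 'I_k -> Z -> Sigma),
    (0 < k)%N /\ loss_in_01 L /\
    limn_esup (fun n : nat =>
      ((ln (minimax_regret L S n) / ln (n%:R : R))%:E : \bar R))
    = ((4 / 7 : R)%:E).
Proof.
exists 7%N, (bool * bool)%type, bool, (@game_loss R), game_signal.
split=> //; split; first exact: game_loss01.
(* The whole sequence converges, so its upper limit is the limit found by squeezing. *)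
apply: (cvg_limn_einf_sup _).2; apply: cvg_EFin; first by near=> n.
apply: squeeze_cvgr (cvg_div_ln_nat (ln (1 / 32))) (cvg_div_ln_nat (ln 3)).
by exists 128%N => // n /= n128; apply: ln_minimax_regret_bounds.
Unshelve. all: by end_near. Qed.
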